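(* Let $(X,d)$ be a metric space that is bi-Lipschitz equivalent to an ultrametric space. Then $(X,d)$ supports a metric cotype $q$ inequality for every $q>1$. In particular, $q_X=1$.
   Context: A metric space $(X,d)$ is an ultrametric space if $d(x,y)\le \max\{d(x,z),d(z,y)\}$ for all $x,y,z\in X$. Two metric spaces $(X,d_X)$, $(Y,d_Y)$ are bi-Lipschitz equivalent if there are $L\ge 1$ and a bijection $\phi\colon Y\to X$ with $d_Y(x,y)/L\le d_X(\phi(x),\phi(y))\le L\,d_Y(x,y)$ for all $x,y\in Y$. Metric cotype. $\mathbb{Z}_m^n$ denotes the $n$-fold product of the integers modulo $m$, and $\mathbf{e}_j$ the $j$th standard basis vector. For $f\colon \mathbb{Z}_m^n\to X$ ($m$ an even positive integer), $1\le j\le n$, and $\delta\in\{-1,0,1\}^n$, put $f_j(\epsilon)=f(\epsilon+\frac m2\mathbf{e}_j)$ and $f_\delta(\epsilon)=f(\epsilon+\delta)$. Let $1\le p\le q<\infty$. A metric space $(X,d)$ supports a $(p,q)$-metric cotype inequality if there are a constant $\Gamma\ge 1$ and a scaling function $m_{p,q}$ from the positive integers to the even positive integers such that for every positive integer $n$, with $m=m_{p,q}(n)$, every mapping $f\colon\mathbb{Z}_m^n\to X$ satisfies $$\mathbb{E}_{\epsilon\in\mathbb{Z}_m^n}\sum_{j=1}^n d(f(\epsilon),f_j(\epsilon))^p\le \Gamma^p m^p n^{1-(p/q)}\,\mathbb{E}_{\epsilon\in\mathbb{Z}_m^n}\mathbb{E}_{\delta\in\{-1,0,1\}^n} d(f(\epsilon),f_\delta(\epsilon))^p,$$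 where the expectations are over uniformly distributed $\epsilon\in\mathbb{Z}_m^n$ and $\delta\in\{-1,0,1\}^n$. ''Supports a metric cotype $q$ inequality'' means supports a $(q,q)$-metric cotype inequality. $q_X=\inf\{q\ge 1:\ \text{there is } 1\le p\le q \text{ such that } X \text{ supports a } (p,q)\text{-metric cotype inequality}\}$. *)

(* Defs.v *)
From mathcomp Require Import all_boot all_order all_algebra.
From mathcomp Require Import boolp classical_sets reals ereal topology exp.

Set Implicit Arguments.
Unset Strict Implicit.
Unset Printing Implicit Defensive.

Import Order.TTheory GRing.Theory Num.Theory.
Local Open Scope classical_set_scope.
Local Open Scope ring_scope.

Definition ultrametric (R : realType) (X : metricType R) : Prop :=
  forall x y z : X, mdist x y <= Num.max (mdist x z) (mdist z y).

Definition bilipschitz_equivalent (R : realType) (X Y : metricType R) : Prop :=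
  exists (L : R) (phi : Y -> X),
    [/\ 1 <= L, bijective phi &
        forall x y : Y,
          mdist x y / L <= mdist (phi x) (phi y) <= L * mdist x y].

(* Expectation over a uniformly distributed element of a finite type. *)
Definition expect (R : realType) (T : finType) (F : T -> R) : R :=
  (\sum_(x : T) F x) / #|T|%:R.

(* 'Z_m is the ring of integers modulo m only for 1 < m; this is used below
   only for positive even m. *)
Definition shift_half (m n : nat) (eps : 'rV['Z_m]_n) (j : 'I_n) :
    'rV['Z_m]_n :=
  eps + (m./2)%:R *: delta_mx 0 j.

(* The cube {-1,0,1}^n is {ffun 'I_n -> 'I_3}, where i : 'I_3 stands for the
   integer i - 1. It is kept apart from 'Z_m because -1 = 1 in 'Z_2, so that
   the uniform law on the cube is not uniform on its image when m = 2. *)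
Definition shift_cube (m n : nat) (eps : 'rV['Z_m]_n)
    (delta : {ffun 'I_n -> 'I_3}) : 'rV['Z_m]_n :=
  eps + \row_j ((delta j : nat)%:R - 1).

Definition metric_cotype_ineq (R : realType) (X : metricType R) (p q Gamma : R)
    (m n : nat) (f : 'rV['Z_m]_n -> X) : Prop :=
  expect (fun eps : 'rV['Z_m]_n =>
    \sum_(j < n) mdist (f eps) (f (shift_half eps j)) `^ p)
  <= Gamma `^ p * m%:R `^ p * n%:R `^ (1 - p / q) *
     expect (fun eps : 'rV['Z_m]_n =>
       expect (fun delta : {ffun 'I_n -> 'I_3} =>
         mdist (f eps) (f (shift_cube eps delta)) `^ p)).

Definition supports_pq_metric_cotype (R : realType) (X : metricType R)
    (p q : R) : Prop :=
  exists (Gamma : R) (scaling : nat -> nat),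
    [/\ 1 <= Gamma,
        forall n : nat, (0 < n)%N -> (0 < scaling n)%N && ~~ odd (scaling n) &
        forall n : nat, (0 < n)%N ->
        forall f : 'rV['Z_(scaling n)]_n -> X,
          metric_cotype_ineq p q Gamma f].

Definition supports_metric_cotype (R : realType) (X : metricType R) (q : R) :
    Prop :=
  supports_pq_metric_cotype X q q.

(* Taken in the extended reals, so that the infimum of the empty set is +oo. *)
Definition cotype_exponent (R : realType) (X : metricType R) : \bar R :=
  ereal_inf [set q%:E | q in
    [set q : R | 1 <= q /\
       exists p : R, 1 <= p <= q /\ supports_pq_metric_cotype X p q]].

(* Main.v *)
(** The [q]-th power of an ultrametric still satisfies the triangle inequality.
    Walking from [eps] to [eps + (m/2) e_j] in [m/2] unit steps therefore gives
    [E d(f, f_j)^q <= (m/2) E d(f, f_(e_j))^q], with the factor [m/2] where a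
    general metric only gives [(m/2)^q]. A unit step is the difference of two
    points of the cube [{-1,0,1}^n] that differ only in their [j]-th coordinate,
    which bounds the last expectation by [3 E E d(f, f_delta)^q]. Summing over
    [j] costs a factor [n], and [n m <= m^q] up to a constant as soon as
    [m >= n^(1/(q-1))]. *)
Require Import Defs.
From mathcomp Require Import all_boot all_order all_algebra.
From mathcomp Require Import boolp classical_sets reals ereal topology exp.
From mathcomp Require Import ring.

Set Implicit Arguments.
Unset Strict Implicit.
Unset Printing Implicit Defensive.

Import Order.TTheory GRing.Theory Num.Theory.
Local Open Scope ring_scope.

Lemma ler_expect (R : realType) (T : finType) (F G : T -> R) :
  (forall x, F x <= G x) -> expect F <= expect G.
Proof. by move=> FG; rewrite ler_wpM2r ?invr_ge0// ler_sum. Qed.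

Lemma expectZ (R : realType) (T : finType) (a : R) (F : T -> R) :
  expect (fun x => a * F x) = a * expect F.
Proof. by rewrite /expect -mulr_sumr mulrA. Qed.

Lemma expect_sum (R : realType) (T I : finType) (F : T -> I -> R) :
  expect (fun x => \sum_i F x i) = \sum_i expect (F^~ i).
Proof. by rewrite /expect exchange_big mulr_suml. Qed.

Lemma expect_shift (R : realType) (V : finZmodType) (v : V) (F : V -> R) :
  expect (fun x => F (x + v)) = expect F.
Proof.
rewrite /expect; congr (_ / _).
by rewrite [RHS](reindex_inj (addIr v)).
Qed.

Section Pseudometric.
Variables (R : realType) (m n : nat).
Let V := 'rV['Z_m]_n.
(** Points at [rho]-distance 0 may differ: [rho] will be the power of a distance pulled back along a
    map [f] that need not be injective. *)
Variable rho : V -> V -> R.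
Hypotheses (rho_ge0 : forall x y, 0 <= rho x y)
           (rhoxx : forall x, rho x x = 0)
           (rho_sym : forall x y, rho x y = rho y x)
           (rho_triangle : forall x y z, rho x z <= rho x y + rho y z).

(** The uniform law is translation invariant, so all [k] steps of the walk have the same expected
    length. *)
Lemma expect_walk (e : V) (k : nat) :
  expect (fun x => rho x (x + k%:R *: e)) <=
  k%:R * expect (fun x => rho x (x + e)).
Proof.
elim: k => [|k IH].
  rewrite mul0r /expect big1 ?mul0r// => x _.
  by rewrite scale0r addr0 rhoxx.
apply: (@le_trans _ _ (expect (fun x => rho x (x + k%:R *: e)) +
          expect (fun x => rho (x + k%:R *: e) (x + k%:R *: e + e)))).
  rewrite /expect -mulrDl -big_split; apply: ler_expect => x.
  by rewrite -natr1 scalerDl scale1r addrA rho_triangle.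
rewrite -natr1 mulrDl mul1r lerD//.
by rewrite (expect_shift (k%:R *: e) (fun x => rho x (x + e))).
Qed.

Let cube := {ffun 'I_n -> 'I_3}.

Definition set_coord (j : 'I_n) (d : cube) (c : 'I_3) : cube :=
  [ffun k => if k == j then c else d k].

Lemma sum_set_coord (F : cube -> R) (j : 'I_n) :
  \sum_d \sum_c F (set_coord j d c) = 3%:R * \sum_d F d.
Proof.
(* Averaging over the rotations of coordinate [j] instead of its values makes
   every summand a permutation of the cube. *)
pose rot (c : 'I_3) (d : cube) : cube :=
  [ffun k => if k == j then d k + c else d k].
have rot_inj c : injective (rot c).
  move=> d d' /ffunP E; apply/ffunP => k; have := E k.
  by rewrite !ffunE; case: eqP => // _ /addIr.
transitivity (\sum_(d : cube) \sum_c F (rot c d)).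
  apply: eq_bigr => d _; rewrite (reindex_inj (addrI (d j))).
  apply: eq_bigr => c _; congr F; apply/ffunP => k; rewrite !ffunE.
  by case: eqP => // ->.
rewrite exchange_big (eq_bigr (fun=> \sum_d F d)) => [|c _].
  by rewrite sumr_const card_ord mulr_natl.
by rewrite [RHS](reindex_inj (rot_inj c)).
Qed.

Lemma expect_unit_step (j : 'I_n) :
  expect (fun x => rho x (x + delta_mx 0 j)) <=
  3%:R * expect (fun x => expect (fun d => rho x (shift_cube x d))).
Proof.
set e := delta_mx 0 j; set A := expect _.
pose G d := expect (fun x => rho x (shift_cube x d)).
have -> : expect (fun x => expect (fun d => rho x (shift_cube x d))) = expect G.
  rewrite /G /expect -!mulr_suml exchange_big /=.
  by rewrite mulrAC.
have G_ge0 d : 0 <= G d by rewrite divr_ge0// sumr_ge0.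
(* As [i : 'I_3] encodes [i - 1], these are the coordinates 0 and 1. *)
pose c0 : 'I_3 := 1; pose c1 : 'I_3 := 1 + 1.
have stepE x d : shift_cube x (set_coord j d c1) =
                 shift_cube x (set_coord j d c0) + e.
  rewrite /shift_cube -addrA; congr (_ + _); apply/rowP => k.
  rewrite !mxE !ffunE eqxx /=; case: eqP => _; last by rewrite addr0.
  by rewrite /= subrK mulr2n addrK.
(* Two of the three values of [c] suffice; the third is added so that [sum_set_coord] applies,
   whence the factor 3. *)
have AG d : A <= \sum_c G (set_coord j d c).
  apply: (@le_trans _ _ (G (set_coord j d c1) + G (set_coord j d c0))); last first.
    rewrite (bigD1 c1)//= (bigD1 c0)//= addrA lerDl.
    by rewrite sumr_ge0.
  (* Translating this expectation by [e] makes the jumps from [x] and from [x + e] land at the same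
     point, which serves as midpoint in the triangle inequality. *)
  have -> : G (set_coord j d c0) =
      expect (fun x => rho (x + e) (shift_cube (x + e) (set_coord j d c0))).
    by rewrite (expect_shift e (fun x => rho x (shift_cube x (set_coord j d c0)))).
  rewrite /G /expect -mulrDl -big_split; apply: ler_expect => x /=.
  have -> : shift_cube (x + e) (set_coord j d c0) = shift_cube x (set_coord j d c1).
    by rewrite stepE /shift_cube addrAC.
  by rewrite [rho (x + e) _]rho_sym.
have cube_gt0 : 0 < #|cube|%:R :> R.
  by rewrite ltr0n; apply/card_gt0P; exists [ffun => 0].
rewrite /(expect G) mulrA ler_pdivlMr// -(sum_set_coord G j) mulr_natr -sumr_const.
by apply: ler_sum => d _; exact: AG.
Qed.

Lemma expect_sum_shift_half :
  expect (fun x => \sum_j rho x (shift_half x j)) <=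
  (3 * n * m./2)%:R * expect (fun x => expect (fun d => rho x (shift_cube x d))).
Proof.
set E := expect (fun x => expect _).
rewrite expect_sum (_ : _%:R * E = \sum_(j < n) (m./2)%:R * (3%:R * E)); last first.
  by rewrite sumr_const card_ord -mulr_natr !natrM; ring.
apply: ler_sum => j _; apply: le_trans (expect_walk _ _) _.
by rewrite ler_wpM2l// expect_unit_step.
Qed.
End Pseudometric.

(** By monotonicity of the power, the left side is at most the larger of two nonnegative
    summands. *)
Lemma ultrametric_powR_triangle (R : realType) (Y : metricType R) (q : R)
    (x y z : Y) :
  ultrametric Y -> 0 <= q ->
  mdist x z `^ q <= mdist x y `^ q + mdist y z `^ q.
Proof.
move=> um q0; have h t : 0 <= t -> mdist x z <= t -> mdist x z `^ q <= t `^ q.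
  by move=> t0; apply: ge0_ler_powR; rewrite // nnegrE mdist_ge0.
have := um x z y; rewrite le_max => /orP[] /h; rewrite mdist_ge0 => /(_ isT).
  by move/le_trans; apply; rewrite lerDl powR_ge0.
by move/le_trans; apply; rewrite lerDr powR_ge0.
Qed.

(** Dividing by [k] leaves [n <= k]^ (q - 1)[, true for every integer]k[above the root]n
    [^ (q - 1)^-1]. This [k] will be half of the scaling value. *)
Lemma exists_scale (R : realType) (q : R) (n : nat) : 1 < q ->
  exists k : nat, (0 < k)%N && (n%:R * k%:R <= k%:R `^ q).
Proof.
move=> q1; have q10 : 0 < q - 1 by rewrite subr_gt0.
exists (Num.truncn (n%:R `^ (q - 1)^-1)).+1 => /=.
set k := _.+1.
rewrite -[q in leRHS](subrK 1) powRD; last by rewrite pnatr_eq0 implybT.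
rewrite powRr1// ler_wpM2r//.
have -> : n%:R = (n%:R `^ (q - 1)^-1) `^ (q - 1) :> R.
  by rewrite -powRrM mulVf ?powRr1// lt0r_neq0.
apply: ge0_ler_powR; rewrite ?nnegrE ?powR_ge0 ?(ltW q10)//.
by rewrite ltW// truncnS_gt.
Qed.

Lemma bilipschitz_ultrametric_cotype (R : realType) (X Y : metricType R)
    (q : R) :
  ultrametric Y -> bilipschitz_equivalent X Y -> 1 < q ->
  supports_metric_cotype X q.
Proof.
move=> um [L [phi [L1 [psi phiK psiK] bil]]] q1.
have L0 : 0 < L := lt_le_trans ltr01 L1.
have q0 : 0 <= q by rewrite (le_trans ler01)// ltW.
have q_neq0 : q != 0 := lt0r_neq0 (lt_trans ltr01 q1).
have powR_le (a b : R) : 0 <= a -> a <= b -> a `^ q <= b `^ q.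
  by move=> a0 ab; apply: ge0_ler_powR; rewrite ?nnegrE ?(le_trans a0 ab).
have XY x y : mdist x y `^ q <= L `^ q * mdist (psi x) (psi y) `^ q.
  rewrite -powRM ?mdist_ge0 ?(ltW L0)//; apply: powR_le; first exact: mdist_ge0.
  by have /andP[_] := bil (psi x) (psi y); rewrite !psiK.
have YX x y : mdist (psi x) (psi y) `^ q <= L `^ q * mdist x y `^ q.
  rewrite -powRM ?mdist_ge0 ?(ltW L0)//; apply: powR_le; first exact: mdist_ge0.
  have /andP[+ _] := bil (psi x) (psi y); rewrite !psiK.
  by rewrite ler_pdivrMr// mulrC.
pose k n := xchoose (exists_scale n q1).
have kP n : (0 < k n)%N && (n%:R * (k n)%:R <= (k n)%:R `^ q :> R).
  exact: (xchooseP (exists_scale n q1)).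
(* One [L] pays for passing from [X] to [Y], the other for returning; the 3 comes from the unit
   step. *)
exists (3%:R * L * L), (fun n => (k n).*2); split.
- by rewrite !mulr_ege1// ler1n.
- by move=> n _; rewrite double_gt0 odd_double; have /andP[->] := kP n.
move=> n n0 f; have /andP[k0 nk] := kP n.
rewrite /metric_cotype_ineq divff ?gt_eqF ?(lt_trans ltr01)// subrr powRr0 mulr1.
pose rho a b := mdist (psi (f a)) (psi (f b)) `^ q.
set E := expect (fun eps => expect _).
have rhoE : expect (fun x => expect (fun d => rho x (shift_cube x d))) <= L `^ q * E.
  rewrite -expectZ; apply: ler_expect => x; rewrite -expectZ.
  by apply: ler_expect => d; exact: YX.
have E0 : 0 <= E.
  rewrite divr_ge0// sumr_ge0// => x _.
  by rewrite divr_ge0// sumr_ge0// => d _; rewrite powR_ge0.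
apply: (@le_trans _ _ (L `^ q * expect (fun x => \sum_j rho x (shift_half x j)))).
  rewrite -expectZ; apply: ler_expect => x; rewrite mulr_sumr.
  by apply: ler_sum => j _; exact: XY.
have rho_half := @expect_sum_shift_half R _ n rho
  (fun a b => powR_ge0 _ _)
  (fun a => etrans (congr1 (powR (R:=R) ^~ q) (mdistxx _)) (powR0 q_neq0))
  (fun a b => congr1 (powR (R:=R) ^~ q) (metric_sym _ _))
  (fun a b c => ultrametric_powR_triangle _ _ _ um q0).
apply: (@le_trans _ _ (L `^ q * ((3 * n * k n)%:R * (L `^ q * E)))).
  rewrite ler_wpM2l ?powR_ge0//; apply: le_trans rho_half _.
  by rewrite doubleK ler_wpM2l.
rewrite !powRM ?mulr_ge0 ?(ltW L0)//.
have -> : L `^ q * ((3 * n * k n)%:R * (L `^ q * E)) =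
   (3%:R * (n%:R * (k n)%:R)) * (L `^ q * L `^ q * E) by rewrite !natrM; ring.
rewrite [leRHS](_ : _ = (3%:R `^ q * (k n).*2%:R `^ q) * (L `^ q * L `^ q * E));
  last by ring.
rewrite ler_wpM2r//; first exact: mulr_ge0 (mulr_ge0 (powR_ge0 _ _) (powR_ge0 _ _)) E0.
apply: ler_pM => //; first by rewrite -[leLHS]powRr1// ler_powR ?ler1n// ltW.
apply: le_trans nk _; apply: powR_le => //.
by rewrite ler_nat -addnn leq_addr.
Qed.

Theorem theorem1p3 (R : realType) (X : metricType R)
    (hX : exists Y : metricType R,
        ultrametric Y /\ bilipschitz_equivalent X Y) :
  (forall q : R, 1 < q -> supports_metric_cotype X q) /\
  cotype_exponent X = 1%:E.
Proof.
have [Y [um bil]] := hX.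
have cot (q : R) : 1 < q -> supports_metric_cotype X q.
  exact: bilipschitz_ultrametric_cotype um bil.
split=> //; apply/eqP; rewrite eq_le; apply/andP; split.
  (* Each [1 + e] with [e > 0] is admissible, with [p = q = 1 + e]; the reverse bound is the
     constraint [1 <= q]. *)
  apply/lee_addgt0Pr => e e0; apply: ereal_inf_lbound.
  have q1 : 1 < 1 + e by rewrite ltrDl.
  exists (1 + e) => //; split; first exact: ltW.
  by exists (1 + e); rewrite lexx (ltW q1); split=> //; exact: cot.
by apply: le_ereal_inf_tmp => _ [q [q1 _] <-]; rewrite lee_fin.
Qed.
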